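(* Let $(X,d,A)$ be a metric pair such that $(X/A,d_1,[A])$ is separable and not uniformly discrete, let $B=\widehat V(X,A)$, let $(J,\Sigma)$ be admissible covariance data on $B$, let $t>0$, let $R\ge1$ be an integer, and let $u_1,\dots,u_R$ be independent samples from the Gaussian measure $\gamma_\Sigma$ on $\ell^2$. Let $$\Phi_R(x):=\frac1{\sqrt R}\bigl(e^{i\sqrt t\,\langle Jx,u_1\rangle_{\ell^2}},\dots,e^{i\sqrt t\,\langle Jx,u_R\rangle_{\ell^2}}\bigr)\in\mathbb C^R,\qquad x\in B,$$ and let $\mathrm{Lip}(\Phi_R)$ be the Lipschitz constant of $\Phi_R\colon(B,\|\cdot\|_{W_1})\to(\mathbb C^R,\|\cdot\|_{\ell^2})$. Let $S\subseteq K(X,A)$ be nonempty and let $\varepsilon>0$. If $\mathrm{Lip}(\Phi_R)>0$, then $$N_{\ell^2}\bigl(\Phi_R(S),\varepsilon\bigr)\le N_{\rho}\!\left(S,\frac{\varepsilon}{\mathrm{Lip}(\Phi_R)}\right).$$ If $\mathrm{Lip}(\Phi_R)=0$, then $\Phi_R$ is constant and $N_{\ell^2}(\Phi_R(S),\varepsilon)=1$.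
   Context: A metric pair $(X,d,A)$ is a metric space with a distinguished subset $A\subseteq X$. Put $d(x,A):=\inf_{a\in A}d(x,a)$ and $d_1(x,y):=\min\bigl(d(x,y),\,d(x,A)+d(y,A)\bigr)$. Let $X/A$ be the quotient collapsing $A$ to a point $[A]$; $d_1$ descends to $X/A$. Standing assumption: $A$ is nonempty and $d_1$ is a genuine metric on $X/A$ (i.e. $d(x,A)>0$ for $x\notin A$). A metric space is uniformly discrete if distances between distinct points are bounded below by some $\varepsilon>0$. $D(X,A):=D(X)/D(A)$, where $D(Y)$ is the free commutative monoid on $Y$. For $\alpha,\beta\in D(X,A)$, $W_1(\alpha,\beta):=\inf_\sigma\sum_{(x,y)\in\sigma}d_1(x,y)$ over $\sigma\in D(X\times X)$ whose marginals agree with $\alpha,\beta$ modulo $D(A)$. $K(X,A)$ is the Grothendieck group of $D(X,A)$ with translation-invariant metric $\rho(\alpha-\beta,\gamma-\delta):=W_1(\alpha+\delta,\gamma+\beta)$. It is the free abelian group with basis $(e_u)_{u\in X/A\setminus\{[A]\}}$. $V(X,A)=V(X)/V(A)$ ($V(Y)$ the free real vector space on $Y$) has basis $(e_u)_{u\in X/A\setminus\{[A]\}}$ and norm $\|\sum_uc_ue_u\|_{W_1}=\sup\{\sum_uc_uf(u): f\colon X/A\to\mathbb R,\ f([A])=0,\ \mathrm{Lip}_{d_1}(f)\le1\}$. $B=\widehat V(X,A)$ is its Banach completion (the Lipschitz-free space $\mathcal F(X/A,d_1)$). $K(X,A)\subset V(X,A)\subset B$ canonically, and $\rho(g,h)=\|g-h\|_{W_1}$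 for $g,h\in K(X,A)$; $\Phi_R$ is applied to $K(X,A)$ through this embedding. Admissible covariance data $(J,\Sigma)$: fix a sequence $(\ell_n)_{n\ge1}\subset B^\ast$ with $\|\ell_n\|_{B^\ast}\le1$ that is norming ($\|x\|_{W_1}=\sup_n|\ell_n(x)|$ for all $x\in B$) and a strictly positive $(w_n)\in\ell^2$; $J\colon B\to\ell^2$, $Jx:=(w_n\ell_n(x))_n$. $\Sigma$ is the positive trace-class operator on the real Hilbert space $\ell^2$ with $\Sigma e_n=\sigma_ne_n$ in the standard basis, $\sigma_n\ge0$, $\sum_n\sigma_n<\infty$. $\gamma_\Sigma$ is the centered Gaussian Radon probability measure on $\ell^2$ with $\int e^{i\langle h,u\rangle}\,d\gamma_\Sigma(u)=\exp(-\tfrac12\langle\Sigma h,h\rangle)$. The statement is for each realization of $u_1,\dots,u_R$. $N_\rho(S,\eta)\in\mathbb N\cup\{\infty\}$ is the smallest number of open $\rho$-balls of radius $\eta$ in $K(X,A)$ covering $S$; $N_{\ell^2}(T,\varepsilon)$ is the smallest number of open $\ell^2$-balls of radius $\varepsilon$ in $\mathbb C^R$ covering $T\subseteq\mathbb C^R$. *)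

(* Defs.v *)
From HB Require Import structures.
From mathcomp Require Import all_boot all_order all_algebra.
From mathcomp Require Import finmap multiset generic_quotient complex.
From mathcomp Require Import all_classical all_reals all_analysis.
From mathcomp Require Import freeg lra.

Set Implicit Arguments.
Unset Strict Implicit.
Unset Printing Implicit Defensive.

Import Order.TTheory GRing.Theory Num.Theory.
Import numFieldNormedType.Exports.

Local Open Scope classical_set_scope.
Local Open Scope quotient_scope.
Local Open Scope ring_scope.

(* The quotient of a commutative monoid M by a submonoid S: x and y are
   identified when x + a = y + b for some a, b in S. *)
Section MonoidQuotient.
Variables (M : nmodType) (S : addrClosed M).

Definition mquot_rel (x y : M) : bool :=
  `[< exists a b, [/\ a \in S, b \in S & x + a = y + b] >].

Lemma mquot_equiv : equiv_class_of mquot_rel.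
Proof.
split=> [x|x y|y x z].
- by apply/asboolP; exists 0, 0; rewrite rpred0.
- by apply/asboolP/asboolP => -[a [b [aS bS e]]]; exists b, a; split.
- move=> /asboolP[a [b [aS bS e]]] /asboolP[c [d [cS dS e']]]; apply/asboolP.
  exists (a + c), (d + b); split; try exact: rpredD.
  by rewrite addrA e addrAC e' addrA.
Qed.

Canonical mquot_equiv_rel := EquivRelPack mquot_equiv.
Canonical mquot_encModRel := defaultEncModRel mquot_rel.

Definition mquot := {eq_quot mquot_rel}.
HB.instance Definition _ : EqQuotient M mquot_rel mquot := EqQuotient.on mquot.
HB.instance Definition _ := Choice.on mquot.

Lemma mquot_relD x x' y y' :
  mquot_rel x x' -> mquot_rel y y' -> mquot_rel (x + y) (x' + y').
Proof.
move=> /asboolP[a [b [aS bS e]]] /asboolP[c [d [cS dS e']]]; apply/asboolP.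
by exists (a + c), (b + d); split; rewrite ?rpredD // addrACA e e' addrACA.
Qed.

Definition mquot_add (x y : mquot) : mquot := \pi_mquot (repr x + repr y).

Lemma mquot_reprP (x : M) : mquot_rel x (repr (\pi_mquot x)).
Proof. by have /esym/eqmodP := reprK (\pi_mquot x). Qed.

Lemma mquot_piD x y : \pi_mquot (x + y) = mquot_add (\pi_mquot x) (\pi_mquot y).
Proof.
by rewrite /mquot_add; apply/eqmodP; apply: mquot_relD; exact: mquot_reprP.
Qed.

Lemma mquot_addA : associative mquot_add.
Proof.
move=> x y z; rewrite -[x]reprK -[y]reprK -[z]reprK.
rewrite -(mquot_piD (repr y)) -(mquot_piD (repr x)) -(mquot_piD (repr x)).
by rewrite -mquot_piD addrA.
Qed.

Lemma mquot_addC : commutative mquot_add.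
Proof. by move=> x y; rewrite /mquot_add addrC. Qed.

Lemma mquot_add0 : left_id (\pi_mquot 0) mquot_add.
Proof. by move=> x; rewrite -[x]reprK -mquot_piD add0r. Qed.

HB.instance Definition _ := GRing.isNmodule.Build mquot
  mquot_addA mquot_addC mquot_add0.

End MonoidQuotient.

(* The Grothendieck group of M is M * M modulo its diagonal submonoid; the pair
   (a, b) represents a - b. *)
Section Grothendieck.
Variable M : nmodType.

Definition diagonal : {pred M * M} := [pred p | p.1 == p.2].

Lemma diagonal_closed : Algebra.nmod_closed diagonal.
Proof.
split=> [|p q]; rewrite !inE //=.
by move=> /eqP-> /eqP->.
Qed.

HB.instance Definition _ := GRing.isAddClosed.Build (M * M)%type diagonal
  diagonal_closed.

Definition groth := mquot diagonal.
HB.instance Definition _ := GRing.Nmodule.on groth.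

Definition groth_opp (x : groth) : groth :=
  \pi_groth ((repr x).2, (repr x).1).

Lemma groth_addN : left_inverse 0 groth_opp +%R.
Proof.
move=> x; rewrite -{2}[x]reprK -[LHS]mquot_piD.
apply/eqmodP/asboolP.
exists 0, ((repr x).2 + (repr x).1, (repr x).2 + (repr x).1).
split; rewrite ?rpred0 ?inE //=.
by rewrite addr0 add0r; congr pair => /=; rewrite addrC.
Qed.

HB.instance Definition _ := GRing.Nmodule_isZmodule.Build groth groth_addN.

End Grothendieck.


(* The library's quotient group V/S, as a module when S is closed under scaling. *)
Section ModuleQuotient.
Variables (R : pzRingType) (V : lmodType R) (S : zmodClosed V).
Hypothesis S_scale : GRing.scaler_closed S.

Definition lquot of GRing.scaler_closed S := Quotient.quot S.
Local Notation Q := (lquot S_scale).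
HB.instance Definition _ := GRing.Zmodule.on Q.
HB.instance Definition _ : EqQuotient V (Quotient.equiv S) Q :=
  EqQuotient.on Q.

Definition lquot_scale (a : R) (x : Q) : Q := \pi_Q (a *: repr x).

Lemma lquot_piZ a x : \pi_Q (a *: x) = lquot_scale a (\pi_Q x).
Proof.
rewrite /lquot_scale; apply/eqmodP; rewrite /= Quotient.equivE -scalerBr.
by apply: S_scale; rewrite Quotient.idealrBE reprK.
Qed.

Lemma lquot_piD x y : \pi_Q (x + y) = \pi_Q x + \pi_Q y.
Proof. exact: Quotient.pi_add. Qed.

Lemma lquot_scaleA a b x :
  lquot_scale a (lquot_scale b x) = lquot_scale (a * b) x.
Proof.
by rewrite -[x]reprK -(lquot_piZ b) -(lquot_piZ a) scalerA -lquot_piZ.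
Qed.

Lemma lquot_scale1 : left_id 1 lquot_scale.
Proof. by move=> x; rewrite -[x]reprK -lquot_piZ scale1r. Qed.

Lemma lquot_scaleDr : right_distributive lquot_scale +%R.
Proof.
move=> a x y; rewrite -[x]reprK -[y]reprK.
by rewrite -lquot_piD -!lquot_piZ -lquot_piD scalerDr.
Qed.

Lemma lquot_scaleDl x : {morph lquot_scale^~ x : a b / a + b}.
Proof.
by move=> a b; rewrite -[x]reprK -!lquot_piZ scalerDl lquot_piD.
Qed.

HB.instance Definition _ := GRing.Zmodule_isLmodule.Build R Q
  lquot_scaleA lquot_scale1 lquot_scaleDr lquot_scaleDl.

End ModuleQuotient.

Definition setdist (R : realType) (T : metricType R) (x : T) (A : set T) : R :=
  inf [set mdist x a | a in A].

(* The last field says that d_1 separates the points of X/A. *)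
Record metricPair (R : realType) := MetricPair {
  mp_space :> metricType R;
  mp_sub : set mp_space;
  mp_sub_neq0 : mp_sub !=set0;
  mp_sub_sep : forall x, ~ mp_sub x -> 0 < setdist x mp_sub
}.

Arguments mp_sub {R} X : rename.
Arguments mp_sub_neq0 {R} X : rename.

Section QuotientSpace.
Variables (R : realType) (X : metricPair R).
Local Notation A := (mp_sub X).
Implicit Types x y z : X.

Definition d1 x y : R := Num.min (mdist x y) (setdist x A + setdist y A).

Definition collapse_rel x y : bool := `[< x = y \/ A x /\ A y >].

Lemma collapse_equiv : equiv_class_of collapse_rel.
Proof.
split=> [x|x y|y x z].
- by apply/asboolP; left.
- by apply/asboolP/asboolP => -[->|[]]; [left|right|left|right].
- move=> /asboolP[->|[Ax Ay]] /asboolP[<-|[Ay' Az]]; apply/asboolP;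
    by [left|right].
Qed.

Canonical collapse_equiv_rel := EquivRelPack collapse_equiv.
Canonical collapse_encModRel := defaultEncModRel collapse_rel.

(* X/A; by collapse_distE below, d_1 descends to it. *)
Definition collapse := {eq_quot collapse_rel}.
HB.instance Definition _ : EqQuotient X collapse_rel collapse :=
  EqQuotient.on collapse.
HB.instance Definition _ := Choice.on collapse.

Definition basept : collapse := \pi_collapse (projT1 (cid (mp_sub_neq0 X))).

Lemma setdist_ge0 x : 0 <= setdist x A.
Proof.
apply: lb_le_inf; first by case: (mp_sub_neq0 X) => a Aa; exists (mdist x a), a.
by move=> _ [a _ <-]; exact: mdist_ge0.
Qed.

Lemma setdist_le x a : A a -> setdist x A <= mdist x a.
Proof.
move=> Aa; apply: ge_inf; last by exists a.
by exists 0 => _ [b _ <-]; exact: mdist_ge0.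
Qed.

Lemma setdist_in x : A x -> setdist x A = 0.
Proof.
move=> Ax; apply/eqP; rewrite eq_le setdist_ge0 andbT.
by rewrite -(mdistxx x); exact: setdist_le.
Qed.

Lemma setdist_triangle x y : setdist x A <= mdist x y + setdist y A.
Proof.
rewrite -lerBlDl; apply: lb_le_inf.
  by case: (mp_sub_neq0 X) => a Aa; exists (mdist y a), a.
move=> _ [a Aa <-]; rewrite lerBlDl.
exact: le_trans (setdist_le x Aa) (metric_triangle _ _ _).
Qed.

Lemma d1_sym x y : d1 x y = d1 y x.
Proof. by rewrite /d1 metric_sym addrC. Qed.

Lemma d1_ge0 x y : 0 <= d1 x y.
Proof. by rewrite le_min mdist_ge0 addr_ge0 ?setdist_ge0. Qed.

Lemma d1_triangle y x z : d1 x z <= d1 x y + d1 y z.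
Proof.
have Hx := setdist_triangle x y; have Hz := setdist_triangle z y.
have Hyz : mdist z y = mdist y z by rewrite metric_sym.
have Ht := metric_triangle x y z; have H0 := setdist_ge0 y.
rewrite ge_min; apply/orP; rewrite /d1.
case: (leP (mdist x y)) => _; case: (leP (mdist y z)) => _;
  by [left; lra|right; lra].
Qed.

Lemma d1_in x y : A x -> A y -> d1 x y = 0.
Proof.
move=> Ax Ay; apply/eqP; rewrite eq_le d1_ge0 andbT.
by rewrite /d1 !setdist_in // addr0 ge_min lexx orbT.
Qed.

Lemma d1_collapse x x' y : collapse_rel x x' -> d1 x y <= d1 x' y.
Proof.
move=> /asboolP[->//|[Ax Ax']]; apply: le_trans (d1_triangle x' _ _) _.
by rewrite d1_in // add0r.
Qed.

Definition collapse_dist (u v : collapse) : R := d1 (repr u) (repr v).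

Lemma collapse_reprP x : collapse_rel x (repr (\pi_collapse x)).
Proof. by have /esym/eqmodP := reprK (\pi_collapse x). Qed.

Lemma collapse_distE x y :
  collapse_dist (\pi_collapse x) (\pi_collapse y) = d1 x y.
Proof.
have h u v : d1 (repr (\pi_collapse u)) v = d1 u v.
  apply/eqP; rewrite eq_le !d1_collapse //; first exact: collapse_reprP.
  have /asboolP[e|[Au Au']] := collapse_reprP u; apply/asboolP.
    by left; exact: esym.
  by right.
by rewrite /collapse_dist h d1_sym h d1_sym.
Qed.

Lemma collapse_distxx u : collapse_dist u u = 0.
Proof.
apply/eqP; rewrite eq_le d1_ge0 andbT.
by rewrite /collapse_dist /d1 mdistxx ge_min lexx.
Qed.

Lemma collapse_dist_eq0 u v : collapse_dist u v = 0 -> u = v.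
Proof.
rewrite -[u]reprK -[v]reprK collapse_distE /d1.
move: (repr u) (repr v) => x y; case: leP => _.
  by move=> /mdist_positivity ->.
move=> /eqP; rewrite paddr_eq0 ?setdist_ge0 // => /andP[/eqP x0 /eqP y0].
apply/eqmodP/asboolP; right; split; apply: contrapT => /mp_sub_sep;
  by rewrite ?x0 ?y0 ltxx.
Qed.

Lemma collapse_dist_sym u v : collapse_dist u v = collapse_dist v u.
Proof. exact: d1_sym. Qed.

Lemma collapse_dist_triangle v u w :
  collapse_dist u w <= collapse_dist u v + collapse_dist v w.
Proof. exact: d1_triangle. Qed.

HB.instance Definition _ := isMetric.Build R collapse collapse_distxx
  collapse_dist_eq0 collapse_dist_sym collapse_dist_triangle.

End QuotientSpace.

(* The free commutative monoid on T, written additively. *)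
Definition fcmon (T : choiceType) := {mset T}%mset.
Identity Coercion fcmon_multiset_of : fcmon >-> multiset_of.
HB.instance Definition _ (T : choiceType) := Choice.on (fcmon T).
HB.instance Definition _ (T : choiceType) :=
  GRing.isNmodule.Build (fcmon T) (@msetDA T) (@msetDC T) (@mset0D T).

Definition fcmon_map (T U : choiceType) (f : T -> U) (s : fcmon T) : fcmon U :=
  seq_mset [seq f x | x <- s].

Section TransportSpaces.
Variables (R : realType) (X : metricPair R).
Local Notation A := (mp_sub X).

Definition DA : {pred fcmon X} := [pred s | `[< forall x, x \in s -> A x >]].

Lemma DA_closed : Algebra.nmod_closed DA.
Proof.
split=> [|s s' /asboolP sA /asboolP sA']; apply/asboolP => x.
  by rewrite in_mset0.
by rewrite in_msetD => /orP[/sA|/sA'].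
Qed.

HB.instance Definition _ := GRing.isAddClosed.Build (fcmon X) DA DA_closed.

Definition DXA := mquot DA.
HB.instance Definition _ := GRing.Nmodule.on DXA.

(* A multiset enumerates its elements with multiplicity. The set below is
   nonempty (mass can be sent to A) and bounded below by 0, so this inf is the
   genuine one. *)
Definition W1 (a b : DXA) : R :=
  inf [set \sum_(p <- s) d1 p.1 p.2 | s in
    [set s : fcmon (X * X)%type | \pi_DXA (fcmon_map fst s) = a
                                  /\ \pi_DXA (fcmon_map snd s) = b]].

Definition KXA := groth DXA.
HB.instance Definition _ := GRing.Zmodule.on KXA.

(* rho (a - b, c - d) = W_1 (a + d, c + b), on chosen representatives (a, b) of g
   and (c, d) of h; the value does not depend on them. *)
Definition rho (g h : KXA) : R :=
  W1 ((repr g).1 + (repr h).2) ((repr h).1 + (repr g).2).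

Definition VA : {pred {freeg X / R}} :=
  [pred v | `[< forall x, coeff x v != 0 -> A x >]].

Lemma VA_closed : GRing.zmod_closed VA.
Proof.
split=> [|v w /asboolP vA /asboolP wA]; apply/asboolP => x.
  by rewrite coeff0 eqxx.
rewrite coeffB; have [->|/vA//] := eqVneq (coeff x v) 0.
by rewrite sub0r oppr_eq0; exact: wA.
Qed.

HB.instance Definition _ := GRing.isZmodClosed.Build {freeg X / R} VA VA_closed.

Lemma VA_scale : GRing.scaler_closed VA.
Proof.
move=> a v /asboolP vA; apply/asboolP => x.
by rewrite coeffZ mulf_eq0 => /norP[_ /vA].
Qed.

Definition VXA := lquot VA_scale.
HB.instance Definition _ := GRing.Lmodule.on VXA.

(* fglift f v is the sum of v_x f(x). As f vanishes at [A], the value depends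
   only on the class of v in V(X)/V(A); the sup is finite because
   |f p| <= d_1 (p, [A]). *)
Definition normW1 (v : VXA) : R :=
  sup [set fglift (fun x : X => f (\pi_(collapse X) x) : R^o) (repr v) | f in
    [set f : collapse X -> R | f (basept X) = 0
                               /\ forall p q, `|f p - f q| <= mdist p q]].

Definition DXA_to_VXA (a : DXA) : VXA :=
  \pi_VXA (\sum_(x <- (repr a : {mset _}%mset)) [freeg [:: (1, x)]]).

(* The canonical embedding a - b |-> a - b of K(X,A) into V(X,A). *)
Definition KXA_to_VXA (g : KXA) : VXA :=
  DXA_to_VXA (repr g).1 - DXA_to_VXA (repr g).2.

End TransportSpaces.

(* A Banach completion of the normed space V(X,A) (unique up to isometric
   isomorphism). *)
Record banach_completion (R : realType) (X : metricPair R)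
    (B : completeNormedModType R) := BanachCompletion {
  bc_map :> {linear VXA X -> B};
  bc_isometry : forall v, `|bc_map v| = normW1 v;
  bc_dense : dense (range bc_map)
}.

Definition separable (T : topologicalType) : Prop :=
  exists2 D : set T, countable D & dense D.

Definition uniformly_discrete (R : realType) (T : metricType R) : Prop :=
  exists2 e : R, 0 < e & forall x y : T, x != y -> e <= mdist x y.

Section Ell2.
Variable R : realType.

Definition ell2_pred : {pred (nat -> R)} :=
  [pred u : nat -> R | `[< cvgn (series (fun n => u n ^+ 2 : R)) >]].

Record ell2 := Ell2 { ell2_val :> nat -> R; ell2P : ell2_val \in ell2_pred }.

HB.instance Definition _ := [isSub for ell2_val].
HB.instance Definition _ := [Choice of ell2 by <:].

Lemma ell2_comparison (c : R) (u v : nat -> R) :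
  (forall n, `|v n| <= c * `|u n|) -> u \in ell2_pred -> v \in ell2_pred.
Proof.
move=> vu /asboolP cu; apply/asboolP.
apply: (@series_le_cvg _ _ (fun n => c ^+ 2 * u n ^+ 2)).
- by move=> n; exact: sqr_ge0.
- by move=> n; rewrite mulr_ge0 ?sqr_ge0.
- move=> n; rewrite -(real_normK (num_real (v n))).
  rewrite -[u n ^+ 2]real_normK ?num_real // -exprMn.
  by rewrite lerXn2r ?nnegrE ?(le_trans (normr_ge0 _) (vu n)).
- exact: is_cvg_seriesZ.
Qed.

Lemma ell2_zero : (fun=> 0) \in ell2_pred.
Proof.
apply/asboolP.
have -> : series (fun=> 0 ^+ 2 : R) = (fun=> 0); last exact: is_cvg_cst.
by apply/funext => n; rewrite /series /= big1 // => i _; rewrite expr0n.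
Qed.

HB.instance Definition _ := isPointed.Build ell2 (Ell2 ell2_zero).

Definition inner (u v : ell2) : R := limn (series (fun n => u n * v n)).

Definition ell2_dist (u v : ell2) : R :=
  Num.sqrt (limn (series (fun n => (u n - v n) ^+ 2))).

Definition ell2_open : set (set ell2) :=
  [set U | forall u, U u -> exists2 e : R, 0 < e &
             forall v, ell2_dist u v < e -> U v].

(* ell^2 with its Borel sigma-algebra, for the topology of ell2_dist. *)
Definition ell2_borel := g_sigma_algebraType ell2_open.

End Ell2.

Definition dual_norm (R : realType) (B : normedModType R)
    (l : {linear B -> R^o}) : \bar R :=
  ereal_sup [set (`|l x|)%:E | x in [set x : B | `|x| <= 1]].

(* cd_sigma is the sequence of eigenvalues of Sigma; sequences are indexed from
   0. *)
Record covariance_data (R : realType) (B : normedModType R) := CovarianceData {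
  cd_ell : nat -> {linear B -> R^o};
  cd_ell_le1 : forall n, (dual_norm (cd_ell n) <= 1)%E;
  cd_norming : forall x : B,
    (`|x|)%:E = ereal_sup (range (fun n => (`|cd_ell n x|)%:E));
  cd_w : ell2 R;
  cd_w_gt0 : forall n, 0 < cd_w n;
  cd_sigma : nat -> R;
  cd_sigma_ge0 : forall n, 0 <= cd_sigma n;
  cd_sigma_sum : cvgn (series cd_sigma)
}.

Section CovarianceOperators.
Variables (R : realType) (B : normedModType R) (D : covariance_data B).

Lemma cd_J_subproof (x : B) : (fun n => cd_w D n * cd_ell D n x) \in @ell2_pred R.
Proof.
apply: (@ell2_comparison _ (`|x|) (cd_w D)); last exact: ell2P.
move=> n; rewrite normrM mulrC ler_wpM2r // -lee_fin (cd_norming D x).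
by apply: ereal_sup_ubound; exists n.
Qed.

Definition cd_J (x : B) : ell2 R := Ell2 (cd_J_subproof x).

Lemma cd_Sigma_subproof (h : ell2 R) :
  (fun n => cd_sigma D n * h n) \in @ell2_pred R.
Proof.
apply: (@ell2_comparison _ (limn (series (cd_sigma D))) h); last exact: ell2P.
move=> n; rewrite normrM ler_wpM2r // ger0_norm ?cd_sigma_ge0 //.
have nd : nondecreasing_seq (series (cd_sigma D)).
  by apply/nondecreasing_seqP => k; rewrite seriesSr lerDl cd_sigma_ge0.
apply: le_trans (nondecreasing_cvgn_le nd (@cd_sigma_sum _ _ D) n.+1).
rewrite seriesSr lerDr; apply: sumr_ge0 => i _; exact: cd_sigma_ge0.
Qed.

Definition cd_Sigma (h : ell2 R) : ell2 R := Ell2 (cd_Sigma_subproof h).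

End CovarianceOperators.

(* gamma is the centered Gaussian measure with covariance operator S: the real
   and imaginary parts of the integral of exp(i <h, u>) are prescribed. The
   Radon property is automatic, since ell^2 is Polish. *)
Definition centered_gaussian (R : realType) (S : ell2 R -> ell2 R)
    (gamma : probability (ell2_borel R) R) : Prop :=
  forall h : ell2 R,
    (\int[gamma]_u (cos (inner h u))%:E = (expR (- 2^-1 * inner (S h) h))%:E)%E
    /\ (\int[gamma]_u (sin (inner h u))%:E = 0)%E.

Definition iid_samples (R : realType) d (Omega : measurableType d)
    (P : probability Omega R) d' (T : measurableType d')
    (mu : probability T R) (m : nat) (U : 'I_m -> {mfun Omega >-> T}) : Prop :=
  (forall r E, measurable E -> P (U r @^-1` E) = mu E) /\
  (forall E : 'I_m -> set T, (forall r, measurable (E r)) ->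
     P (\bigcap_r (U r @^-1` E r)) = (\prod_(r < m) P (U r @^-1` E r))%E).

Definition cexpi (R : realType) (a : R) : R[i] := (cos a +i* sin a)%C.

Definition Phi (R : realType) (B : normedModType R) (D : covariance_data B)
    (t : R) (m : nat) (u : 'I_m -> ell2 R) (x : B) : 'rV[R[i]]_m :=
  \row_r (((Num.sqrt m%:R)^-1)%:C%C *
          cexpi (Num.sqrt t * inner (cd_J D x) (u r))).

(* The Euclidean distance of C^m; the library's norm on row vectors is the sup
   norm. *)
Definition Cdist (R : realType) (m : nat) (z z' : 'rV[R[i]]_m) : R :=
  Num.sqrt (\sum_(r < m) ComplexField.Normc.normc (z 0 r - z' 0 r) ^+ 2).

(* The least Lipschitz constant, +oo if there is none. *)
Definition lip_const (R : realType) (T1 T2 : Type) (dist1 : T1 -> T1 -> R)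
    (dist2 : T2 -> T2 -> R) (f : T1 -> T2) : \bar R :=
  ereal_inf [set L%:E | L in
    [set L : R | 0 <= L /\ forall x y, dist2 (f x) (f y) <= L * dist1 x y]].

(* The smallest number of open balls of radius r (with centres anywhere in T)
   covering S, +oo if no finite number suffices. *)
Definition covering_number (R : realType) (T : Type) (dist : T -> T -> R)
    (S : set T) (r : R) : \bar R :=
  ereal_inf [set n%:R%:E | n in
    [set n : nat | exists c : 'I_n -> T,
                     forall x, S x -> exists i, dist (c i) x < r]].

(* Main.v *)
Require Import Defs.
From HB Require Import structures.
From mathcomp Require Import all_boot all_order all_algebra.
From mathcomp Require Import finmap multiset generic_quotient complex.
From mathcomp Require Import all_classical all_reals all_analysis.
From mathcomp Require Import freeg.

Set Implicit Arguments.
Unset Strict Implicit.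
Unset Printing Implicit Defensive.

Import Order.TTheory GRing.Theory Num.Theory.
Import numFieldNormedType.Exports.

Local Open Scope classical_set_scope.
Local Open Scope ring_scope.

(** An [L]-Lipschitz map sends an open ball of radius [eps / L] into the open
    ball of radius [eps] around the image of the centre, so it carries a cover
    of [S] to a cover of its image of the same size ([covering_number_le]). Two
    points make this apply here.

    First, the infimum that defines the Lipschitz constant is attained
    ([lip_const_attained]), so [PhiR] satisfies the Lipschitz inequality with
    [LipPhi] itself.

    Second, that inequality is measured in the norm of [B], whereas the balls in
    K(X,A) are measured by [rho]. The easy half of Kantorovich duality bridges
    the two ([normW1_le_rho]): a function [f] that is 1-Lipschitz for [d1] and
    vanishes at the base point pairs with [g - h] to at most the cost of any
    transport plan, because it gains at most [d1 x y] along each transported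
    unit (x, y). Taking the supremum over [f] and the infimum over plans bounds
    the norm of [g - h] by [rho g h]. The pairing with [f] has to be compared
    across D(X,A) and V(X,A), which is the object of [pairD_pi], [pairV_pi] and
    [pairV_DXA].

    When the Lipschitz constant is [+oo], its real part is 0 by convention, so
    the balls on the right have radius 0 and are empty, [rho] being nonnegative;
    they cannot cover the nonempty set [S], and the right-hand side is [+oo].
    When the constant is 0, all points have the same image, and a single ball
    around it suffices. *)

(** * Lipschitz maps and covering numbers *)

Section LipschitzCovering.
Variables (R : realType) (T1 T2 : Type).
Variables (dist1 : T1 -> T1 -> R) (dist2 : T2 -> T2 -> R).

Lemma lip_const_ge0 (f : T1 -> T2) : (0 <= lip_const dist1 dist2 f)%E.
Proof. by apply: le_ereal_inf_tmp => _ [L [L0 _] <-]; rewrite lee_fin. Qed.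

(** For [dist1 x y > 0] this is the infimum of the constraints
    [dist2 (f x) (f y) / dist1 x y <= K]. Pairs at distance 0 give no such
    quotient; there any finite admissible [K] gives the bound, which is 0 for
    every constant. *)
Lemma lip_const_attained (f : T1 -> T2) (L : R) :
    (forall x y, 0 <= dist1 x y) -> lip_const dist1 dist2 f = L%:E ->
  forall x y, dist2 (f x) (f y) <= L * dist1 x y.
Proof.
move=> dist1_ge0 fL x y.
have := dist1_ge0 x y; rewrite le_eqVlt => /orP[/eqP d0|d_gt0].
  (* Otherwise the infimum would be over the empty set, hence [+oo]. *)
  have [_ [K [_ fK] _]] : [set L%:E | L in [set L : R | 0 <= L /\
      forall x y, dist2 (f x) (f y) <= L * dist1 x y]] !=set0.
    apply/set0P/eqP => e; move: fL.
    by rewrite /lip_const e ereal_inf0.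
  by have := fK x y; rewrite -d0 !mulr0.
rewrite -ler_pdivrMr // -lee_fin -fL.
by apply: le_ereal_inf_tmp => _ [K [_ fK] <-]; rewrite lee_fin ler_pdivrMr.
Qed.

(** The images of the centres are centres of a cover of the image. *)
Lemma covering_number_le (S : set T1) (f : T1 -> T2) (r1 r2 : R) :
    (forall x y, dist1 x y < r1 -> dist2 (f x) (f y) < r2) ->
  (covering_number dist2 [set f x | x in S] r2
    <= covering_number dist1 S r1)%E.
Proof.
move=> fr; apply: le_ereal_inf => _ [n [c cS] <-]; exists n => //.
exists (f \o c) => _ [x Sx <-]; have [k ck] := cS x Sx.
by exists k; exact: fr.
Qed.

Lemma covering_number_le0 (S : set T1) (r : R) :
    (forall x y, 0 <= dist1 x y) -> S !=set0 -> r <= 0 ->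
  covering_number dist1 S r = +oo%E.
Proof.
move=> dist1_ge0 [x Sx] r0; apply/eqP; rewrite -leye_eq.
apply: le_ereal_inf_tmp => _ [n [c cS] <-]; have [k] := cS x Sx.
by move=> /lt_le_trans/(_ r0); rewrite ltNge dist1_ge0.
Qed.

Lemma covering_number1 (S : set T1) (r : R) (c : T1) :
  S !=set0 -> (forall x, S x -> dist1 c x < r) -> covering_number dist1 S r = 1%E.
Proof.
move=> [x0 Sx0] cS; apply/eqP; rewrite eq_le; apply/andP; split.
  by apply: ereal_inf_lbound; exists 1%N => //; exists (fun=> c) => x /cS; exists ord0.
apply: le_ereal_inf_tmp => _ [[|n] [b bS] <-].
  by have [[]] := bS _ Sx0.
by rewrite lee_fin ler1n.
Qed.

End LipschitzCovering.

(** * Sums over elements of the free commutative monoid *)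

Lemma big_seq_mset (T : choiceType) (V : nmodType) (F : T -> V) (s : seq T) :
  \sum_(x <- seq_mset s) F x = \sum_(x <- s) F x.
Proof. exact: perm_big (perm_eq_seq_mset s). Qed.

Lemma seq_mset_cat (T : choiceType) (s s' : seq T) :
  seq_mset (s ++ s') = (seq_mset s : fcmon T) + (seq_mset s' : fcmon T).
Proof. by apply/msetP => x; rewrite msetE2 !mset_seqE count_cat. Qed.

Lemma big_fcmonD (T : choiceType) (V : nmodType) (F : T -> V) (s s' : fcmon T) :
  \sum_(x <- (s + s' : fcmon T)) F x = \sum_(x <- s) F x + \sum_(x <- s') F x.
Proof.
by rewrite -{1}[s]seq_mset_id -{1}[s']seq_mset_id -seq_mset_cat big_seq_mset big_cat.
Qed.

Lemma big_fcmon_map (T U : choiceType) (V : nmodType) (f : T -> U) (F : U -> V)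
    (s : fcmon T) :
  \sum_(y <- fcmon_map f s) F y = \sum_(x <- s) F (f x).
Proof. by rewrite big_seq_mset big_map. Qed.

Lemma fcmon_map_seq_mset (T U : choiceType) (f : T -> U) (s : seq T) :
  fcmon_map f (seq_mset s) = seq_mset (map f s).
Proof. by apply/eq_seq_msetP/perm_map/perm_eq_seq_mset. Qed.

HB.instance Definition _ (R : nzRingType) (K : choiceType) (M : lmodType R)
    (f : K -> M) :=
  GRing.isZmodMorphism.Build {freeg K / R} M (fglift f) (lift_is_additive f).

(** * Weak Kantorovich duality *)

Section WeakDuality.
Variables (R : realType) (X : metricPair R).
Local Notation A := (mp_sub X).

Section Potential.
Variable F : X -> R.
Hypothesis F_A : forall x, A x -> F x = 0.

(** Both pairings sum the potential over a chosen representative; [pairD_pi] and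
    [pairV_pi] show that any other representative gives the same value. *)
Definition pairD (a : DXA X) : R := \sum_(x <- (repr a : fcmon X)) F x.

Definition pairV (v : VXA X) : R := fglift (F : X -> R^o) (repr v).

Lemma sum_DA (s : fcmon X) : s \in @DA R X -> \sum_(x <- s) F x = 0.
Proof.
by move=> /asboolP sA; rewrite big_seq big1 // => x /sA; exact: F_A.
Qed.

(** Two representatives of a class differ by elements of D(A), on which the
    potential sums to 0. *)
Lemma pairD_pi (s : fcmon X) : pairD (\pi_(DXA X)%qT s) = \sum_(x <- s) F x.
Proof.
have /asboolP[a [b [/sum_DA a0 /sum_DA b0 e]]] := mquot_reprP (@DA R X) s.
have := congr1 (fun s : fcmon X => \sum_(x <- s) F x) e.
by rewrite !big_fcmonD a0 b0 !addr0.
Qed.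

Lemma pairD_add (a b : DXA X) : pairD (a + b) = pairD a + pairD b.
Proof. exact: etrans (pairD_pi _) (big_fcmonD _ _ _). Qed.

Lemma fglift_VA (v : {freeg X / R}) : v \in @VA R X -> fglift (F : X -> R^o) v = 0.
Proof.
move=> /asboolP vA; rewrite -[v]Freeg_dom fglift_Freeg /prelift big_map.
rewrite big_seq big1 // => x; rewrite mem_dom => /vA/F_A /= ->.
exact: scaler0.
Qed.

(** The difference of two representatives lies in V(A), on which the potential
    vanishes. *)
Lemma pairV_pi (v : {freeg X / R}) :
  pairV (\pi_(VXA X)%qT v) = fglift (F : X -> R^o) v.
Proof.
apply/eqP; rewrite -subr_eq0 -lift_is_additive; apply/eqP/fglift_VA.
by have /eqmodP := reprK (\pi_(VXA X) v)%qT; rewrite /= Quotient.equivE.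
Qed.

Lemma pairVB (v w : VXA X) : pairV (v - w) = pairV v - pairV w.
Proof.
rewrite -{1}[v]reprK -{1}[w]reprK.
have -> : (\pi_(VXA X) (repr v) - \pi_(VXA X) (repr w) =
           \pi_(VXA X) (repr v - repr w))%qT.
  by rewrite lquot_piD; congr (_ + _); exact/esym/Quotient.pi_opp.
by rewrite pairV_pi lift_is_additive.
Qed.

Lemma pairV_DXA (a : DXA X) : pairV (DXA_to_VXA a) = pairD a.
Proof.
rewrite pairV_pi raddf_sum; apply: eq_bigr => x _.
by rewrite /= fglift_Freeg prelift_seq1 scale1r.
Qed.

End Potential.

(** All the mass of [a] can be sent to one point of A, and all the mass of [b]
    taken from it: the marginals then exceed [a] and [b] only by elements of
    D(A). Without a coupling the infimum in [W1] would be the junk value 0 of an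
    empty infimum, and [pairD_le_W1] could fail. *)
Lemma coupling_exists (a b : DXA X) : exists s : fcmon (X * X)%type,
  (\pi_(DXA X) (fcmon_map fst s) = a /\ \pi_(DXA X) (fcmon_map snd s) = b)%qT.
Proof.
have [a0 Aa0] := mp_sub_neq0 X.
have padD (c : DXA X) (s' : seq X) : (forall x, x \in s' -> A x) ->
    (\pi_(DXA X) ((repr c : fcmon X) + (seq_mset s' : fcmon X)) = c)%qT.
  move=> s'A; rewrite -[RHS]reprK; apply/eqmodP/asboolP.
  exists 0, (seq_mset s'); split; rewrite ?rpred0 ?addr0 //.
  apply/asboolP => x; rewrite (perm_mem (perm_eq_seq_mset s')); exact: s'A.
exists (seq_mset ([seq (x, a0) | x <- (repr a : fcmon X)]
               ++ [seq (a0, y) | y <- (repr b : fcmon X)])).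
have cA (s : seq X) : forall x, x \in [seq a0 | _ <- s] -> A x.
  by move=> x /mapP[_ _ ->].
have fstK (s : seq X) : map fst [seq (x, a0) | x <- s] = s.
  by rewrite -map_comp map_id.
have sndK (s : seq X) : map snd [seq (a0, y) | y <- s] = s.
  by rewrite -map_comp map_id.
rewrite !fcmon_map_seq_mset !map_cat fstK sndK -!map_comp.
rewrite !seq_mset_cat !seq_mset_id.
by split; last rewrite addrC; apply: padD => x; exact: cA.
Qed.

Lemma W1_ge0 (a b : DXA X) : 0 <= W1 a b.
Proof.
apply: lb_le_inf.
  by have [s sab] := coupling_exists a b; exists (\sum_(p <- s) d1 p.1 p.2), s.
by move=> _ [s _ <-]; apply: sumr_ge0 => p _; exact: d1_ge0.
Qed.

(** For a plan [s] with marginals [a] and [b] the left side is the sum of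
    [F x - F y] over the pairs (x, y) of [s], which is termwise at most the cost
    of [s]. *)
Lemma pairD_le_W1 (F : X -> R) (a b : DXA X) :
    (forall x, A x -> F x = 0) -> (forall x y, F x - F y <= d1 x y) ->
  pairD F a - pairD F b <= W1 a b.
Proof.
move=> FA F1; apply: lb_le_inf.
  by have [s sab] := coupling_exists a b; exists (\sum_(p <- s) d1 p.1 p.2), s.
move=> _ [s [<- <-] <-]; rewrite !pairD_pi // !big_fcmon_map -sumrB.
exact: ler_sum.
Qed.

(** For a potential [f], the pairing with (g1 - g2) - (h1 - h2) regroups as the
    pairing with g1 + h2 minus the pairing with h1 + g2, and [rho] is [W1] of
    these two elements. *)
Lemma normW1_le_rho (g h : KXA X) :
  normW1 (KXA_to_VXA g - KXA_to_VXA h) <= rho g h.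
Proof.
apply: ge_sup.
  (* The zero potential. *)
  set f0 : collapse X -> R := fun=> 0; eexists; exists f0; last by [].
  by split=> // p q; rewrite subrr normr0 mdist_ge0.
move=> _ [f [f0 f1] <-].
set F := fun x : X => f (\pi_(collapse X) x)%qT.
have FA x : A x -> F x = 0.
  move=> Ax; rewrite -f0; congr f; apply/eqmodP/asboolP; right; split=> //.
  exact: projT2 (cid (mp_sub_neq0 X)).
have F1 x y : F x - F y <= d1 x y.
  apply: le_trans (ler_norm _) _; rewrite -collapse_distE; exact: f1.
rewrite -[leLHS]/(pairV F _) !pairVB // !pairV_DXA //.
rewrite opprB addrACA -opprD [X in _ - X]addrC -!pairD_add //.
exact: pairD_le_W1.
Qed.

End WeakDuality.

(** * The Euclidean distance on complex row vectors *)

Lemma Cdist_ge0 (R : realType) (m : nat) (z z' : 'rV[R[i]]_m) : 0 <= Cdist z z'.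
Proof. exact: sqrtr_ge0. Qed.

Lemma Cdistxx (R : realType) (m : nat) (z : 'rV[R[i]]_m) : Cdist z z = 0.
Proof.
rewrite /Cdist big1 ?sqrtr0 // => r _.
by rewrite subrr ComplexField.Normc.normc0 expr0n.
Qed.

Lemma Cdist_le0 (R : realType) (m : nat) (z z' : 'rV[R[i]]_m) :
  Cdist z z' <= 0 -> z = z'.
Proof.
move=> d0; have /eqP : Cdist z z' = 0 by apply: le_anti; rewrite d0 Cdist_ge0.
rewrite sqrtr_eq0 => s0; apply/rowP => r.
have : \sum_(r < m) ComplexField.Normc.normc (z 0 r - z' 0 r) ^+ 2 == 0.
  by rewrite eq_le s0 sumr_ge0 // => k _; exact: sqr_ge0.
rewrite psumr_eq0 => [/allP/(_ r)|k _]; last exact: sqr_ge0.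
rewrite mem_index_enum sqrf_eq0 => /(_ isT)/eqP/ComplexField.Normc.eq0_normc/eqP.
by rewrite subr_eq0 => /eqP.
Qed.

(** * Covering numbers of the image *)

Theorem corollary4p11 (R : realType) (X : metricPair R)
    (Xsep : separable (collapse X)) (Xnud : ~ uniformly_discrete (collapse X))
    (B : completeNormedModType R) (iota : banach_completion X B)
    (D : covariance_data B) (t : R) (t_gt0 : 0 < t) (m : nat) (m_ge1 : (1 <= m)%N)
    (gamma : probability (ell2_borel R) R)
    (gammaG : centered_gaussian (cd_Sigma D) gamma)
    (d : measure_display) (Omega : measurableType d) (P : probability Omega R)
    (U : 'I_m -> {mfun Omega >-> ell2_borel R}) (Uiid : iid_samples P gamma U)
    (omega : Omega) (S : set (KXA X)) (S_neq0 : S !=set0)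
    (eps : R) (eps_gt0 : 0 < eps) :
  let PhiR : B -> 'rV[R[i]]_m := Phi D t (fun r => U r omega) in
  let LipPhi : \bar R :=
    lip_const (fun x y : B => `|x - y|) (@Cdist R m) PhiR in
  let PhiS : set 'rV[R[i]]_m := [set PhiR (iota (KXA_to_VXA g)) | g in S] in
  ((0 < LipPhi)%E ->
     (covering_number (@Cdist R m) PhiS eps
      <= covering_number (@rho R X) S (eps / fine LipPhi))%E) /\
  (LipPhi = 0%E ->
     (forall x y : B, PhiR x = PhiR y) /\
     covering_number (@Cdist R m) PhiS eps = 1%E).
Proof.
move=> PhiR LipPhi PhiS.
have lipP (L : R) (x y : B) : LipPhi = L%:E ->
    Cdist (PhiR x) (PhiR y) <= L * `|x - y|.
  by move=> LE; apply: (lip_const_attained _ LE) => ? ?; exact: normr_ge0.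
split=> [Lip_gt0|Lip0].
  case LE : LipPhi => [L| |].
  - have L_gt0 : 0 < L by rewrite -lte_fin -LE.
    apply: (@covering_number_le _ _ _ _ _ S (fun g => PhiR (iota (KXA_to_VXA g)))).
    move=> g h; rewrite /= ltr_pdivlMr // mulrC; apply: le_lt_trans.
    apply: le_trans (lipP _ _ _ LE) _; rewrite ler_pM2l //.
    by rewrite -linearB bc_isometry normW1_le_rho.
  - rewrite [leRHS]covering_number_le0 ?leey //=; last by rewrite invr0 mulr0.
    by move=> g h; exact: W1_ge0.
  - by have := lip_const_ge0 (fun x y : B => `|x - y|) (@Cdist R m) PhiR;
      rewrite -/LipPhi LE.
have Phi_cst x y : PhiR x = PhiR y.
  by apply: Cdist_le0; rewrite -(mul0r `|x - y|); exact: lipP.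
split=> //; have [g Sg] := S_neq0.
apply: (@covering_number1 _ _ _ _ _ (PhiR 0)).
  by exists (PhiR (iota (KXA_to_VXA g))), g.
by move=> _ [h _ <-]; rewrite (Phi_cst _ 0) Cdistxx.
Qed.
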